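(* Let $\alpha>-2$ and let $\rho$ be a probability density on $[0,1]^2$ (with respect to Lebesgue measure) which is continuous on $[0,1]^2\setminus\{(1,1)\}$ and satisfies $$\rho(x,y)=\Theta\left(d^{\alpha}\right)\quad\text{as }(x,y)\to(1,1),$$ where $d:=|x-1|+|y-1|$. Then $$\mathbb{E}\left[\mathrm{LIS}\left(\mathrm{Sample}_N(\mu_\rho)\right)\right]=\widetilde{\Theta}\left(\sqrt{N}\right)\quad\text{as }N\to\infty.$$
   Context: For points $X_1,\dots,X_N\in[0,1]^2$ with pairwise distinct $x$-coordinates and pairwise distinct $y$-coordinates, $\mathrm{Perm}(X_1,\dots,X_N)$ is the permutation $\sigma$ of $\{1,\dots,N\}$ such that $\sigma(i)=j$ whenever the point with $i$-th lowest $x$-coordinate has $j$-th lowest $y$-coordinate. A pre-permuton is a probability measure $\mu$ on $[0,1]^2$ whose two marginals have no atoms. For a pre-permuton $\mu$, $\mathrm{Sample}_N(\mu)$ denotes the random permutation $\mathrm{Perm}(X_1,\dots,X_N)$ where $X_1,\dots,X_N$ are i.i.d. with law $\mu$ (almost surely well defined). For a probability density $\rho$ on $[0,1]^2$ with respect to Lebesgue measure, $\mu_\rho$ is the probability measure with density $\rho$. For a permutation $\sigma$ of size $N$, $\mathrm{LIS}(\sigma)$ is the maximal $k$ such that there exist $i_1<\dots<i_k$ with $\sigma(i_1)<\dots<\sigma(i_k)$. For functions, $F=\Theta(G)$ as $(x,y)\to(1,1)$ means that there are constants $0<c_1\le c_2$ such that $c_1G\le F\le c_2G$ at all points of $[0,1]^2\setminus\{(1,1)\}$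 in some neighborhood of $(1,1)$. For sequences of positive reals, $a_N=\widetilde{\mathcal O}(b_N)$ means that there exist $c_1>0$, $c_2\in\mathbb{R}$ and $N_0$ with $a_N\le c_1\log(N)^{c_2}b_N$ for all $N\ge N_0$; and $a_N=\widetilde{\Theta}(b_N)$ means $a_N=\widetilde{\mathcal O}(b_N)$ and $b_N=\widetilde{\mathcal O}(a_N)$. *)

(* Defs.v *)
From HB Require Import structures.
From mathcomp Require Import all_boot all_order all_algebra all_fingroup.
From mathcomp Require Import all_classical all_reals all_analysis.

Set Implicit Arguments.
Unset Strict Implicit.
Unset Printing Implicit Defensive.

Import Order.TTheory GRing.Theory Num.Theory.
Import numFieldNormedType.Exports.

Local Open Scope classical_set_scope.
Local Open Scope ring_scope.

(** Permutations of [{1, ..., N}] are represented as ['S_N], i.e. shifted to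
    [{0, ..., N - 1}]. *)

Section Permutations.
Variable N : nat.

Definition has_increasing_subseq (s : 'S_N) (k : nat) : bool :=
  [exists t : k.-tuple 'I_N,
     sorted ltn [seq val i | i <- t] && sorted ltn [seq val (s i) | i <- t]].

Definition LIS (s : 'S_N) : nat :=
  \max_(k < N.+1 | has_increasing_subseq s k) k.

End Permutations.

Section Points.
Variables (R : realType) (N : nat).
Implicit Type X : N.-tuple (measurableTypeR R * measurableTypeR R).

(** [xrank X k = i] iff the [k]-th point has the [i]-th lowest abscissa (counting
    from 0) when the abscissas are pairwise distinct. *)
Definition xrank X (k : 'I_N) : nat :=
  #|[pred j : 'I_N | ((tnth X j).1 < (tnth X k).1 :> R)]|.

Definition yrank X (k : 'I_N) : nat :=
  #|[pred j : 'I_N | ((tnth X j).2 < (tnth X k).2 :> R)]|.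

Definition is_Perm X (s : 'S_N) : bool :=
  [forall i : 'I_N, forall j : 'I_N, forall k : 'I_N,
     (xrank X k == i) && (yrank X k == j) ==> (s i == j)].

(** The value is arbitrary when two points share a coordinate; see [Perm_uniq]
    for the other case. *)
Definition Perm X : 'S_N := odflt 1%g [pick s | is_Perm X s].

Lemma rank_inj (f : 'I_N -> R) : injective f ->
  injective (fun k => #|[pred j : 'I_N | f j < f k]|).
Proof.
move=> finj.
have W k l : #|[pred j | f j < f k]| = #|[pred j | f j < f l]| -> f k <= f l.
  move=> kl; rewrite leNgt; apply/negP => lk; move/eqP: kl; apply/negP.
  rewrite neq_ltn; apply/orP; right; apply: fintype.proper_card; apply/fintype.properP; split.
    by apply/fintype.subsetP => j; rewrite !inE => /lt_trans; apply.
  by exists l; rewrite !inE ?ltxx.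
by move=> k l /= kl; apply/finj/eqP; rewrite eq_le !W.
Qed.

Lemma rank_lt (f : 'I_N -> R) (k : 'I_N) : (#|[pred j | (f j < f k)%R]| < N)%N.
Proof.
rewrite -[ltnRHS](card_ord N); apply: fintype.proper_card; apply/fintype.properP; split.
  by apply/fintype.subsetP.
by exists k; rewrite // !inE ltxx.
Qed.

Lemma Perm_uniq X : injective (fun k => (tnth X k).1) ->
    injective (fun k => (tnth X k).2) ->
  is_Perm X (Perm X) /\ forall s, is_Perm X s -> s = Perm X.
Proof.
move=> inj1 inj2.
pose r1 k : 'I_N := Ordinal (rank_lt (fun k => (tnth X k).1) k).
pose r2 k : 'I_N := Ordinal (rank_lt (fun k => (tnth X k).2) k).
have r1I : injective r1 by move=> k l [] /(rank_inj inj1).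
have r2I : injective r2 by move=> k l [] /(rank_inj inj2).
pose s0 : 'S_N := ((perm r1I)^-1 * perm r2I)%g.
have s0E k : s0 (r1 k) = r2 k by rewrite permM -(permE r1I) permK permE.
have s0P : is_Perm X s0.
  apply/forallP => i; apply/forallP => j; apply/forallP => k.
  apply/implyP => /andP[/eqP ki /eqP kj].
  have -> : i = r1 k by apply: val_inj; rewrite /= -ki.
  by rewrite s0E; apply/eqP/val_inj; rewrite /= -kj.
have s0U s : is_Perm X s -> s = s0.
  move=> sP; apply/permP => i; rewrite -[i](permKV (perm r1I)).
  set k := (_ i); rewrite permE s0E.
  move/forallP/(_ (r1 k))/forallP/(_ (r2 k))/forallP/(_ k): sP.
  by rewrite !eqxx => /eqP.
rewrite /Perm; case: pickP => [s sP|/(_ s0)]; last by rewrite s0P.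
by split=> // s' /s0U ->; rewrite (s0U _ sP).
Qed.

End Points.

Section Iid.
Context d (T : measurableType d) (R : realType).
Variable mu : probability T R.

Definition cons_pair n (z : T * n.-tuple T) : n.+1.-tuple T :=
  [the n.+1.-tuple T of z.1 :: z.2].

Lemma measurable_cons_pair n : measurable_fun setT (@cons_pair n).
Proof. by apply: measurable_cons => //. Qed.

HB.instance Definition _ n :=
  isMeasurableFun.Build _ _ _ _ (@cons_pair n) (@measurable_cons_pair n).

(** The law of [(X_1, ..., X_N)], with the [X_i] i.i.d. of law [mu]; see
    [iid_law_box]. *)
Fixpoint iid_law (N : nat) : probability (N.-tuple T) R :=
  match N with
  | 0 => dirac [tuple]
  | n.+1 => distribution (mu \x iid_law n)%E (@cons_pair n)
  end.

Lemma iid_law_box (N : nat) (A : 'I_N -> set T) :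
    (forall i, measurable (A i)) ->
  iid_law N [set X | forall i, A i (tnth X i)] = (\prod_(i < N) mu (A i))%E.
Proof.
elim: N A => [|n IH] A mA.
  rewrite big_ord0 /= diracE mem_set// => i; by case: i.
rewrite big_ord_recl /= -IH; last by move=> i; exact: mA.
rewrite /distribution /pushforward.
rewrite (_ : _ @^-1` _ =
  A ord0 `*` [set X | forall i : 'I_n, A (lift ord0 i) (tnth X i)]).
  rewrite product_measure1E//.
  rewrite (_ : [set X | _] = \bigcap_(i in [set: 'I_n])
     ((@tnth n T) ^~ i) @^-1` (A (lift ord0 i))); last first.
    by apply/seteqP; split=> X /= h i; [move=> _; exact: h | exact: h].
  apply: fin_bigcap_measurable => // i _.
  rewrite -[X in measurable X]setTI.
  by apply: measurable_tnth => //; exact: mA.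
apply/seteqP; split=> -[x X] /=.
  move=> h; split; first by have := h ord0; rewrite tnth0.
  by move=> i; have := h (lift ord0 i); rewrite tnthS.
move=> [h0 h] i; case: (unliftP ord0 i) => [j|] ->.
  by rewrite tnthS.
by rewrite tnth0.
Qed.

End Iid.

Section Density.
Variable R : realType.

Definition unit_square : set (R * R) := `[0, 1] `*` `[0, 1].

Definition corner : R * R := (1, 1).

Definition lebesgue2 := (@lebesgue_measure R \x @lebesgue_measure R)%E.

Definition is_density (rho : R * R -> R) : Prop :=
  [/\ measurable_fun (unit_square : set (measurableTypeR R * measurableTypeR R))
        (rho : measurableTypeR R * measurableTypeR R -> R),
      forall z, unit_square z -> 0 <= rho z &
      (\int[lebesgue2]_(z in unit_square) (rho z)%:E = 1)%E].

Definition density_law (rho : R * R -> R) (rhoP : is_density rho)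
    (A : set (measurableTypeR R * measurableTypeR R)) : \bar R :=
  (\int[lebesgue2]_(z in A `&` unit_square) (rho z)%:E)%E.

End Density.

Section DensityLaw.
Context (R : realType) (rho : R * R -> R) (rhoP : is_density rho).

Local Notation mu := (density_law rhoP).

Let measurable_unit_square :
  measurable (@unit_square R : set (measurableTypeR R * measurableTypeR R)).
Proof. by apply: measurableX; exact: measurable_itv. Qed.

Let mu0 : mu set0 = 0%E.
Proof. by rewrite /density_law set0I integral_set0. Qed.

Let mu_ge0 A : (0 <= mu A)%E.
Proof.
have [_ rho_ge0 _] := rhoP; apply: integral_ge0 => z [_ /rho_ge0].
by rewrite lee_fin.
Qed.

Let mu_semi_sigma_additive : semi_sigma_additive mu.
Proof.
have [mrho rho_ge0 _] := rhoP; move=> F mF tF mUF.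
rewrite /density_law setI_bigcupl ge0_integral_bigcup //.
- by apply: is_cvg_ereal_nneg_natsum_cond => n _ _; exact: mu_ge0.
- by move=> k; exact: measurableI.
- apply/measurable_realfun.measurable_EFinP; apply: measurable_funS mrho => //.
  by move=> z [k _ []].
- by move=> z [k _ [_ /rho_ge0]]; rewrite lee_fin.
- exact: trivIset_setIr.
Qed.

HB.instance Definition _ :=
  isMeasure.Build _ _ _ mu mu0 mu_ge0 mu_semi_sigma_additive.

Let mu_setT : mu setT = 1%E.
Proof. by have [_ _ rho1] := rhoP; rewrite /density_law setTI. Qed.

HB.instance Definition _ := Measure_isProbability.Build _ _ _ mu mu_setT.

End DensityLaw.

Section Asymptotics.
Variable R : realType.
Implicit Types (F G : R * R -> R) (a b : nat -> R).

Definition Theta_corner F G : Prop :=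
  exists c1 c2 : R, 0 < c1 <= c2 /\
    \forall z \near @corner R, unit_square z -> z <> @corner R ->
      c1 * G z <= F z <= c2 * G z.

Definition tildeO a b : Prop :=
  exists (c1 c2 : R) (N0 : nat), 0 < c1 /\
    forall N, (N0 <= N)%N -> a N <= c1 * ln N%:R `^ c2 * b N.

Definition tildeTheta a b : Prop := tildeO a b /\ tildeO b a.

End Asymptotics.

(** [Sample_N(mu)] is the random permutation [Perm] on the probability space
    [iid_law mu N].  The expectation of its [LIS] is finite, since
    [LIS] is at most [N] on ['S_N], so that [fine] loses nothing. *)
Definition expected_LIS (R : realType)
    (mu : probability (measurableTypeR R * measurableTypeR R)%type R) (N : nat) : R :=
  fine 'E_(iid_law mu N)[fun X => (LIS (Perm X))%:R].

(* Main.v *)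
From mathcomp Require Import all_fingroup.
Require Import Defs.
From mathcomp Require Import all_boot all_order all_algebra.
From mathcomp Require Import all_classical all_reals all_analysis.
From mathcomp Require Import measurable_realfun ring lra.

(** Write [d] for the distance [|x - 1| + |y - 1|] to the corner.  Since
    [d ^ 2 >= (1 - x) (1 - y)], the density is dominated by a product
    [K g(x) g(y)] with [g(x) = (1 - x) ^ (min(alpha, 0) / 2)], and [g] is
    integrable because [alpha > -2].  Cutting both axes at the quantiles of [g]
    therefore gives, for every [M], a grid whose cells all have mass
    [O(1 / M ^ 2)].

    Upper bound: use the grid with [M = k].  The cells visited by an increasing
    chain of [k] points form two weakly increasing sequences, of which there are
    at most [4 ^ k] each, so by a union bound a chain of length [k] exists with
    probability at most [(16 C N / k ^ 2) ^ k].  This is at most [1 / N] once [k]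
    is a large multiple of [sqrt N].

    Lower bound: near the corner there is a square on which the density is
    bounded below.  Split it into about [sqrt N] boxes along the diagonal; each
    contains a sample point with probability bounded below, and one point from
    each nonempty box yields an increasing chain. *)

Set Implicit Arguments.
Unset Strict Implicit.
Unset Printing Implicit Defensive.

Import Order.TTheory GRing.Theory Num.Theory.
Import numFieldNormedType.Exports.

Local Open Scope classical_set_scope.
Local Open Scope ring_scope.

Local Notation plane R := (measurableTypeR R * measurableTypeR R)%type.

(** * Increasing subsequences and increasing chains of points *)

Section LongestIncreasingSubsequence.
Variable N : nat.
Implicit Type s : 'S_N.

Lemma has_increasing_subseq_LIS s k :
  has_increasing_subseq s k -> (k <= LIS s)%N.
Proof.
move=> sk; have kN : (k < N.+1)%N.
  case/existsP: sk => t /andP[/(sorted_uniq ltn_trans ltnn) ut _].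
  rewrite (map_inj_uniq val_inj) in ut.
  by rewrite ltnS -(size_tuple t) -[leqRHS](card_ord N) -(card_uniqP ut) max_card.
exact: (@leq_bigmax_cond _ (fun i : 'I_N.+1 => has_increasing_subseq s i)
  val (Ordinal kN)).
Qed.

Lemma has_increasing_subseq0 s : has_increasing_subseq s 0.
Proof. by apply/existsP; exists [tuple]. Qed.

Lemma has_increasing_subseq_leq s k l : (k <= l)%N ->
  has_increasing_subseq s l -> has_increasing_subseq s k.
Proof.
move=> kl /existsP[t /andP[t1 t2]]; apply/existsP.
have kt : size (take k t) == k by rewrite size_takel// size_tuple.
exists (Tuple kt); rewrite /= !map_take.
by rewrite !take_sorted.
Qed.

Lemma leq_LIS_has_increasing_subseq s k :
  (k <= LIS s)%N -> has_increasing_subseq s k.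
Proof.
move/has_increasing_subseq_leq; apply.
rewrite /LIS; apply: (big_ind (fun m => has_increasing_subseq s m)) => //.
  exact: has_increasing_subseq0.
by move=> a b ha hb; rewrite /maxn; case: ifP.
Qed.

Lemma LIS_leq s : (LIS s <= N)%N.
Proof. by apply/bigmax_leqP => i _; rewrite -ltnS. Qed.

End LongestIncreasingSubsequence.

Section PermChains.
Variables (R : realType) (N : nat).
Variable X : N.-tuple (measurableTypeR R * measurableTypeR R).
Hypothesis injx : injective (fun k => (tnth X k).1).
Hypothesis injy : injective (fun k => (tnth X k).2).

Definition increasing_points (p : seq 'I_N) :=
  sorted (fun i j => (tnth X i).1 < (tnth X j).1 :> R) p &&
  sorted (fun i j => (tnth X i).2 < (tnth X j).2 :> R) p.

Let rank_ltE (f : 'I_N -> R) (k l : 'I_N) :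
  (#|[pred j | (f j < f k)%R]| < #|[pred j | (f j < f l)%R]|)%N = (f k < f l).
Proof.
have W a b : f a <= f b -> (#|[pred j | (f j < f a)%R]| <= #|[pred j | (f j < f b)%R]|)%N.
  move=> ab; apply: subset_leq_card; apply/fintype.subsetP => j; rewrite !inE.
  by move=> /lt_le_trans; apply.
apply/idP/idP => [|kl].
  by apply: contraTT; rewrite -leNgt -leqNgt => /W.
apply: fintype.proper_card; apply/fintype.properP; split.
  by apply/fintype.subsetP => j; rewrite !inE => /lt_trans; apply.
by exists k; rewrite !inE ?ltxx.
Qed.

(** The map [r1] from a point to its abscissa rank is a bijection, and [Perm X] sends [r1 a] to
    [r2 a]. Positions in the permutation thus correspond to sample points, with both orders
    preserved. *)
Lemma has_increasing_subseq_PermP k :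
  has_increasing_subseq (Perm X) k <->
  exists p : k.-tuple 'I_N, increasing_points p.
Proof.
have [sP _] := Perm_uniq injx injy.
pose r1 k : 'I_N := Ordinal (rank_lt (fun k => (tnth X k).1) k).
pose r2 k : 'I_N := Ordinal (rank_lt (fun k => (tnth X k).2) k).
have r1I : injective r1 by move=> a b [] /(rank_inj injx).
have sE a : Perm X (r1 a) = r2 a.
  move/forallP/(_ (r1 a))/forallP/(_ (r2 a))/forallP/(_ a): sP.
  by rewrite !eqxx => /eqP.
have r1E i j : (r1 i < r1 j)%N = ((tnth X i).1 < (tnth X j).1 :> R).
  exact: (rank_ltE (fun k => (tnth X k).1)).
have r2E i j : (r2 i < r2 j)%N = ((tnth X i).2 < (tnth X j).2 :> R).
  exact: (rank_ltE (fun k => (tnth X k).2)).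
have key (p : seq 'I_N) :
    sorted ltn [seq val i | i <- map r1 p] &&
      sorted ltn [seq val (Perm X i) | i <- map r1 p] = increasing_points p.
  rewrite -!map_comp !sorted_map /increasing_points; congr (_ && _).
    by apply: eq_sorted => i j /=; rewrite r1E.
  by apply: eq_sorted => i j /=; rewrite !sE r2E.
split=> [/existsP[t]|[p] pP].
  pose p := map_tuple (perm r1I)^-1%g t; rewrite (_ : tval t = map r1 p).
    by rewrite key => pP; exists p.
  rewrite /= -map_comp -[LHS]map_id; apply: eq_map => i /=.
  by rewrite -[r1 _](permE r1I) permKV.
apply/existsP; exists (map_tuple r1 p).
by rewrite [tval _]/= key.
Qed.

End PermChains.

(** * Union bounds for i.i.d. samples *)

Section MeasureBounds.
Context d (T : measurableType d) (R : realType).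
Implicit Type mu : {measure set T -> \bar R}.

Lemma le_measure_fin_bigcup mu (I : finType) (P : {pred I}) (F : I -> set T)
    (r : R) : (forall i, measurable (F i)) ->
    (forall i, (mu (F i) <= r%:E)%E) ->
  (mu (\bigcup_(i in [set` P]) F i) <= (#|P|%:R * r)%:E)%E.
Proof.
move=> mF Fr; rewrite bigcup_pred.
(* Measurability is carried through the induction because subadditivity asks for it at each step. *)
have : measurable (\big[setU/set0]_(i in P) F i) /\
    (mu (\big[setU/set0]_(i in P) F i) <= ((\sum_(i in P) 1%N)%N%:R * r)%:E)%E.
  apply: (big_rec2 (fun A n => measurable A /\ (mu A <= (n%:R * r)%:E)%E)).
    by rewrite measure0 mul0r.
  move=> i n A _ [mA An]; split; first exact: measurableU.
  rewrite (le_trans (measureU2 _ _ _))// natrD mulrDl mul1r EFinD.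
  exact: leeD (Fr i) An.
by rewrite sum1_card => -[].
Qed.

(** Unlike [ge0_le_integral], this needs no measurability, so [LIS] of the sample
    is never shown to be measurable. *)
Lemma le_ge0_integral mu (f g : T -> \bar R) : (forall x, 0 <= f x)%E ->
  (forall x, f x <= g x)%E -> (\int[mu]_x f x <= \int[mu]_x g x)%E.
Proof.
move=> f0 fg.
rewrite !ge0_integralTE//; last by move=> x; exact: le_trans (fg x).
apply: ereal_sup_le => _ [h hf <-]; exists h => // x.
exact: le_trans (hf x) (fg x).
Qed.

End MeasureBounds.

Section IidTuples.
Context d (T : measurableType d) (R : realType).
Variables (mu : probability T R) (N : nat).

Definition points_in k (t : k.-tuple 'I_N) (A : 'I_k -> set T) :
    set (N.-tuple T) :=
  [set X | forall j, A j (tnth X (tnth t j))].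

Lemma measurable_points_in k (t : k.-tuple 'I_N) A :
  (forall j, measurable (A j)) -> measurable (points_in t A).
Proof.
move=> mA; rewrite (_ : points_in t A = \bigcap_(j in [set: 'I_k])
    ((@tnth N T) ^~ (tnth t j)) @^-1` A j); last first.
  by apply/seteqP; split=> X /= h j; [move=> _; exact: h|exact: h].
apply: fin_bigcap_measurable => // j _.
rewrite -[X in measurable X]setTI.
by apply: measurable_tnth => //; exact: mA.
Qed.

(** Distinct indices select independent points. Giving the whole space to every index outside [t]
    turns the event into a box in all [N] coordinates. *)
Lemma iid_law_points_in_le k (t : k.-tuple 'I_N) A (r : R) : uniq t ->
    (forall j, measurable (A j)) -> (forall j, (mu (A j) <= r%:E)%E) ->
  (iid_law mu N (points_in t A) <= (r ^+ k)%:E)%E.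
Proof.
move=> ut mA Ar.
pose B i := [set z | forall j, tnth t j = i -> A j z].
have BE j : B (tnth t j) = A j.
  apply/seteqP; split=> [z /(_ j)|z Az l]; first exact.
  by move/(tuple_uniqP _ ut) ->.
have BT i : i \notin t -> B i = setT.
  by move=> it; apply/seteqP; split=> // z _ j ji; rewrite -ji mem_tnth in it.
have mB i : measurable (B i).
  have [/tnthP[j ->]|/BT->] := boolP (i \in t); first by rewrite BE.
  exact: measurableT.
rewrite (_ : points_in t A = [set X | forall i, B i (tnth X i)]); last first.
  by apply/seteqP; split=> X /= h; [move=> i j <-|move=> j; apply: h].
rewrite iid_law_box//.
have rE : r ^+ k = \prod_(i < N) (if i \in t then r else 1).
  rewrite -big_mkcond/= prodr_const; congr (_ ^+ _).
  by rewrite (card_uniqP ut) size_tuple.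
rewrite rE -prodEFin.
suff : (0 <= \prod_(i < N) mu (B i) <= \prod_(i < N)
    ((if i \in t then r else 1)%:E))%E by case/andP.
apply: (big_rec2 (fun x y : \bar R => 0 <= x <= y)%E).
  by rewrite lexx lee01.
move=> i x y _ /andP[x0 xy]; rewrite mule_ge0//=.
apply: lee_pmul => //.
case: ifPn => [/tnthP[j ->]|/BT->]; first by rewrite BE.
by rewrite probability_setT.
Qed.

End IidTuples.

(** * The upper bound from a grid *)

Section GridBoundedLaw.
Variable R : realType.

(** [q M] cuts each axis into at most [M + 1] intervals numbered from left to
    right; every resulting grid cell carries mass at most [C / M ^ 2]. *)
Definition grid_bounded (mu : probability (plane R) R) (C : R)
    (q : nat -> R -> nat) : Prop :=
  forall M, (0 < M)%N ->
  [/\ {homo q M : x y / x <= y >-> (x <= y)%N}, forall x, (q M x <= M)%N &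
      forall i j, (mu ((q M @^-1` [set i]) `*` (q M @^-1` [set j]))
                   <= (C / M%:R ^+ 2)%:E)%E].

Definition tie N (b : bool) (i j : 'I_N) : set (N.-tuple (plane R)) :=
  [set X | if b then (tnth X i).1 = (tnth X j).1 :> R
           else (tnth X i).2 = (tnth X j).2 :> R].

Lemma measurable_tie N b (i j : 'I_N) : measurable (tie b i j).
Proof.
pose u (X : N.-tuple (plane R)) (k : 'I_N) : measurableTypeR R :=
  if b then (tnth X k).1 else (tnth X k).2.
have mxy k : measurable_fun setT (u ^~ k).
  rewrite /u; case: (b); apply: measurableT_comp => //; exact: measurable_tnth.
have /(_ measurableT [set true]) := measurable_fun_eqr (mxy i) (mxy j).
rewrite setTI => /(_ I); congr measurable; apply/seteqP.
by split=> X; rewrite /tie /u /=; case: (b) => /eqP.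
Qed.

(** The exceptional event off which [Perm_uniq] applies. The Boolean selects the axis, and the
    finite index set allows a union bound. *)
Definition with_ties N : set (N.-tuple (plane R)) :=
  \bigcup_(c in [set` [pred c : bool * 'I_N * 'I_N | c.1.2 != c.2]])
    tie c.1.1 c.1.2 c.2.

Lemma measurable_with_ties N : measurable (@with_ties N).
Proof.
rewrite /with_ties bigcup_pred; apply: bigsetU_measurable => c _.
exact: measurable_tie.
Qed.

Lemma without_ties_inj N (X : N.-tuple (plane R)) : ~ with_ties X ->
  injective (fun k => (tnth X k).1) /\ injective (fun k => (tnth X k).2).
Proof.
move=> nX; split=> i j ij; apply/eqP/negPn/negP => ne; apply: nX.
  by exists (true, i, j).
by exists (false, i, j).
Qed.

Variables (mu : probability (plane R) R) (C : R) (q : nat -> R -> nat).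
Hypothesis qP : grid_bounded mu C q.
Hypothesis C1 : 1 <= C.

Let cell M i j : set (plane R) := (q M @^-1` [set i]) `*` (q M @^-1` [set j]).

(** A level set of the monotone [q M] is an interval, hence Borel. *)
Let measurable_cell M i j : (0 < M)%N -> measurable (cell M i j).
Proof.
move=> M0; have [qh _ _] := qP M0.
have mq k : measurable (q M @^-1` [set k] : set (measurableTypeR R)).
  apply: is_interval_measurable => x y /= xk yk z /andP[/qh xz /qh zy].
  by apply/eqP; rewrite eqn_leq -{1}yk zy -xk xz.
exact: measurableX.
Qed.

(** Tied points share a cell index on one axis, which leaves [(M + 1) ^ 3] pairs of cells, each of
    probability at most [(C / M ^ 2) ^ 2]. The total is at most [8 C ^ 2 / M] for every positive
    [M]. *)
Lemma iid_law_tie N b (i j : 'I_N) : i != j ->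
  (iid_law mu N (tie b i j) = 0)%E.
Proof.
move=> ij; have ut : uniq [tuple i; j] by rewrite /= inE ij.
have bound M : (0 < M)%N ->
    (iid_law mu N (tie b i j) <= ((8 * C ^+ 2) / M%:R)%:E)%E.
  move=> M0; have [_ qM qmu] := qP M0.
  (* The triple [c] holds the shared index, then the other index of each of the two points. *)
  pose F (c : 'I_M.+1 * 'I_M.+1 * 'I_M.+1) (l : 'I_2) :=
    let d := if l == ord0 then c.1.2 else c.2 in
    if b then cell M c.1.1 d else cell M d c.1.1.
  have mF c l : measurable (F c l).
    by rewrite /F; case: (b); exact: measurable_cell.
  have sub : tie b i j `<=` \bigcup_(c in [set` predT]) points_in [tuple i; j] (F c).
    move=> X Xij; pose u (k : 'I_N) : R := if b then (tnth X k).1 else (tnth X k).2.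
    pose v (k : 'I_N) : R := if b then (tnth X k).2 else (tnth X k).1.
    pose o x : 'I_M.+1 := @Ordinal M.+1 (q M x) (qM x).
    exists (o (u i), o (v i), o (v j)) => // l.
    have uij : u i = u j by move: Xij; rewrite /tie /u /=; case: (b).
    rewrite /F /cell; case: (unliftP ord0 l) => [m|] ->.
      rewrite (ord1 m) (tnth_nth i) /= uij /u /v; by case: (b).
    rewrite (tnth_nth i) /= /u /v; by case: (b).
  rewrite (le_trans (le_measure _ _ _ sub))// ?inE.
  - exact: measurable_tie.
  - rewrite bigcup_pred; apply: bigsetU_measurable => c _.
    by apply: measurable_points_in => l; exact: mF.
  rewrite (le_trans (@le_measure_fin_bigcup _ _ _ _ _ _ _ ((C / M%:R ^+ 2) ^+ 2) _ _))//.
  - by move=> c; apply: measurable_points_in => l; exact: mF.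
  - move=> c; apply: iid_law_points_in_le => // l.
    by rewrite /F; case: (b); exact: qmu.
  rewrite lee_fin !card_prod !card_ord.
  have M0' : 0 < M%:R :> R by rewrite ltr0n.
  have M1 : M.+1%:R <= 2 * M%:R :> R by rewrite -natrM ler_nat mul2n -addnn -addn1 leq_add2l.
  rewrite !natrM (_ : 8 * C ^+ 2 / M%:R =
    (2 * M%:R) * (2 * M%:R) * (2 * M%:R) * (C / M%:R ^+ 2) ^+ 2); last first.
    by field; rewrite gt_eqF.
  by rewrite ler_wpM2r ?sqr_ge0// !ler_pM ?mulr_ge0.
have := fin_num_measure (iid_law mu N) _ (measurable_tie b i j).
move=> /fineK pE; move: bound; rewrite -pE; set p := fine _ => bound.
have p0 : 0 <= p by exact: fine_ge0.
congr EFin; apply/eqP; rewrite eq_le p0 andbT leNgt.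
apply/negP => pp; pose K := 8 * C ^+ 2.
(* This grid parameter exceeds [K / p], so the bound falls below [p]. *)
have := bound (Num.truncn (K / p)).+1 isT; rewrite lee_fin leNgt => /negP; apply.
by rewrite ltr_pdivrMr// -ltr_pdivrMl// mulrC; exact: truncnS_gt.
Qed.

Lemma iid_law_with_ties N : (iid_law mu N (@with_ties N) = 0)%E.
Proof.
apply/eqP; rewrite eq_le measure_ge0 andbT.
have -> : 0%E = (#|[pred c : bool * 'I_N * 'I_N | c.1.2 != c.2]|%:R * 0)%:E :> \bar R.
  by rewrite mulr0.
rewrite /with_ties !bigcup_pred.
(* The union bound wants an estimate at every index, so the excluded ones receive the empty set. *)
rewrite (eq_bigr (fun c => if c.1.2 != c.2 then tie c.1.1 c.1.2 c.2 else set0)); last first.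
  by move=> c; rewrite inE => ->.
rewrite -bigcup_pred; apply: le_measure_fin_bigcup => c.
  by case: ifP => // _; exact: measurable_tie.
case: ifPn => [/(iid_law_tie c.1.1) c0|_]; last by rewrite measure0.
suff : (iid_law mu N (tie c.1.1 c.1.2 c.2) <= 0)%E by [].
by rewrite c0.
Qed.

(** The index set of the union bound: distinct sample indices with the column and row numbers of
    their cells. The numbers increase only weakly, since points of a chain may share a column or a
    row. *)
Definition increasing_cells N k :
    {set k.-tuple 'I_N * (k.-tuple 'I_k.+1 * k.-tuple 'I_k.+1)} :=
  let S := [set a : k.-tuple 'I_k.+1 | sorted leq (map val a)]%SET in
  finset.setX [set t : k.-tuple 'I_N | uniq t]%SET (finset.setX S S).

(** Weakly increasing [k]-tuples with [k + 1] possible values number ['C(2 k, k) <= 4 ^ k], and each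
    axis contributes one such factor. *)
Lemma card_increasing_cells N k :
  (#|increasing_cells N k| <= N ^ k * 16 ^ k)%N.
Proof.
rewrite !finset.cardsX !card_sorted_tuples leq_mul//.
  by rewrite (leq_trans (max_card _))// card_tuple card_ord.
have -> : (16 ^ k = 2 ^ (k + k) * 2 ^ (k + k))%N.
  by rewrite addnn -mul2n expnM -expnMn.
(* A binomial coefficient is one term in the expansion of [(1 + 1) ^ n]. *)
have W n m : ('C(n, m) <= 2 ^ n)%N.
  have [mn|/bin_small->//] := leqP m n.
  rewrite -[2%N]/(1 + 1)%N expnDn (bigD1 (inord m)) //= inordK// !exp1n !muln1.
  exact: leq_addr.
exact: leq_mul.
Qed.

(** The grid parameter is the length [k] of the chain itself. *)
Definition chain_cells N k : set (N.-tuple (plane R)) :=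
  \bigcup_(c in [set` increasing_cells N k])
    points_in c.1 (fun j => cell k (tnth c.2.1 j) (tnth c.2.2 j)).

Lemma measurable_chain_cells N k : (0 < k)%N -> measurable (@chain_cells N k).
Proof.
move=> k0; rewrite /chain_cells bigcup_pred.
apply: bigsetU_measurable => c _; apply: measurable_points_in => j.
exact: measurable_cell.
Qed.

(** There are at most [(16 N) ^ k] choices of indices and cells, each of probability at most
    [(C / k ^ 2) ^ k]. *)
Lemma iid_law_chain_cells N k : (0 < k)%N ->
  (iid_law mu N (@chain_cells N k) <= ((16 * N%:R * C / k%:R ^+ 2) ^+ k)%:E)%E.
Proof.
move=> k0; have [_ _ qmu] := qP k0.
rewrite /chain_cells !bigcup_pred.
rewrite (eq_bigr (fun c => if c \in increasing_cells N k then
   points_in c.1 (fun j => cell k (tnth c.2.1 j) (tnth c.2.2 j)) else set0)); last first.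
  by move=> c ->.
rewrite -bigcup_pred.
rewrite (le_trans (@le_measure_fin_bigcup _ _ _ _ _ _ _ ((C / k%:R ^+ 2) ^+ k) _ _))//.
- move=> c; case: ifP => // _; apply: measurable_points_in => j.
  exact: measurable_cell.
- have r0 : 0 <= C / k%:R ^+ 2 by rewrite divr_ge0 ?sqr_ge0// (le_trans _ C1).
  move=> [t ab] /=; case: ifPn => [|_]; last first.
    by rewrite measure0 lee_fin exprn_ge0.
  rewrite !finset.in_setX inE => /andP[ut _].
  apply: iid_law_points_in_le => // j; first exact: measurable_cell.
  exact: qmu.
rewrite lee_fin (_ : 16 * N%:R * C / k%:R ^+ 2 = (N * 16)%:R * (C / k%:R ^+ 2)); last first.
  by rewrite natrM; ring.
rewrite [leRHS]exprMn ler_wpM2r ?exprn_ge0 ?divr_ge0 ?sqr_ge0 ?(le_trans _ C1)//.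
by rewrite -natrX expnMn ler_nat card_increasing_cells.
Qed.

(** Strictly increasing abscissas make the indices of a chain distinct, and monotonicity of [q k]
    makes its cell numbers weakly increasing. *)
Lemma LIS_chain_cells N k (X : N.-tuple (plane R)) : (0 < k)%N ->
  ~ with_ties X -> (k <= LIS (Perm X))%N -> chain_cells k X.
Proof.
move=> k0 /without_ties_inj[ix iy] /leq_LIS_has_increasing_subseq.
move=> /(has_increasing_subseq_PermP ix iy)[p /andP[px py]].
have [qh qM _] := qP k0.
pose o x : 'I_k.+1 := @Ordinal k.+1 (q k x) (qM x).
exists (p, (map_tuple (fun i => o (tnth X i).1) p,
            map_tuple (fun i => o (tnth X i).2) p)); last first.
  by move=> j; rewrite !tnth_map.
rewrite /= !finset.in_setX !inE -!map_comp !sorted_map /=; apply/and3P; split.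
- apply: (@sorted_uniq _ (fun i j => (tnth X i).1 < (tnth X j).1 :> R)) => //.
  by move=> a b c; exact: lt_trans.
- by move: px; apply: sub_sorted => i j /= /ltW /qh.
- by move: py; apply: sub_sorted => i j /= /ltW /qh.
Qed.

(** [LIS] is at most [k] off the event [B] and at most [N] on it. As [B] has probability at most
    [1 / N], the expectation is at most [k + 1]. *)
Lemma expected_LIS_le_sqrt N : (0 < N)%N ->
  expected_LIS mu N <= (8 * Num.sqrt C + 2) * Num.sqrt N%:R.
Proof.
(* The factor 8 gives [k ^ 2 >= 64 N C], which brings the ratio [16 N C / k ^ 2] down to [1 / 4]. *)
move=> N0; pose K := 8 * Num.sqrt (N%:R * C); pose k := (Num.truncn K).+1.
have C0 : 0 < C by exact: lt_le_trans C1.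
have N1 : 1 <= N%:R :> R by rewrite ler1n.
have k0 : (0 < k)%N by [].
have Kk : K <= k%:R by rewrite ltW// truncnS_gt.
have kK : k%:R <= K + 1.
  by rewrite -natr1 lerD2r truncn_le// mulr_ge0.
have k0' : 0 < k%:R ^+ 2 :> R by rewrite exprn_gt0.
have k64 : 64 * (N%:R * C) <= k%:R ^+ 2.
  have -> : 64 * (N%:R * C) = K ^+ 2.
    by rewrite /K exprMn sqr_sqrtr ?mulr_ge0 ?(ltW C0)//; ring.
  by rewrite ler_pXn2r ?nnegrE// mulr_ge0.
pose B := @chain_cells N k `|` @with_ties N.
have mB : measurable B.
  by apply: measurableU; [exact: measurable_chain_cells|exact: measurable_with_ties].
have PB : (iid_law mu N B <= (N%:R^-1)%:E)%E.
  apply: (le_trans (measureU2 _ _ _)).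
  - exact: measurable_chain_cells.
  - exact: measurable_with_ties.
  rewrite [X in (_ + X)%E](_ : _ = 0%E) ?adde0; last exact: iid_law_with_ties.
  apply: (le_trans (iid_law_chain_cells _ _)) => //.
  have h4 : 16 * N%:R * C / k%:R ^+ 2 <= 4^-1.
    by rewrite ler_pdivrMr//; lra.
  rewrite lee_fin (le_trans (lerXn2r _ _ _ h4)) ?nnegrE//.
    by rewrite divr_ge0// ?mulr_ge0// ltW.
  rewrite exprVn lef_pV2 ?posrE ?exprn_gt0 ?ltr0n//.
  (* This follows from [k < 2 ^ k]; together with [k64] and [C >= 1] it yields [N <= 4 ^ k]. *)
  have : k%:R ^+ 2 <= 4 ^+ k :> R.
    by rewrite -!natrX ler_nat (_ : 4 = 2 ^ 2)%N// -expnM mulnC expnM leq_exp2r// ltnW// ltn_expl.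
  by have : N%:R * 1 <= N%:R * C by [rewrite ler_pM2l ?ltr0n]; lra.
have bnd : ('E_(iid_law mu N)[fun X => (LIS (Perm X))%:R] <= (k%:R + 1)%:E)%E.
  rewrite unlock.
  apply: (@le_trans _ _ (\int[iid_law mu N]_X (k%:R%:E + N%:R%:E * (\1_B X)%:E))%E).
    apply: le_ge0_integral => X; first by rewrite lee_fin.
    rewrite indicE; case: (boolP (X \in B)) => XB.
      rewrite mule1 -EFinD lee_fin -natrD ler_nat.
      by rewrite (leq_trans (LIS_leq _))// leq_addl.
    rewrite mule0 adde0 lee_fin ler_nat leqNgt; apply/negP => /ltnW kL.
    move/negP: XB; apply; rewrite inE.
    have [|nt] := pselect (with_ties X); first by right.
    by left; exact: LIS_chain_cells.
  rewrite ge0_integralD//=; last first.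
    by apply/measurable_EFinP; apply: measurable_funM => //; exact: measurable_indic.
  rewrite integral_cst//= probability_setT mule1.
  rewrite ge0_integralZl//=; last first.
    by apply/measurable_EFinP; exact: measurable_indic.
  rewrite integral_indic// setIT EFinD leeD2l//.
  by rewrite (le_trans (lee_wpmul2l _ PB))// -EFinM divff// gt_eqF// ltr0n.
have E0 : (0 <= 'E_(iid_law mu N)[fun X => (LIS (Perm X))%:R])%E.
  by apply: expectation_ge0 => X.
rewrite /expected_LIS.
move: E0 bnd; case: ('E_ _ [_])%E => [e| |] //=.
rewrite !lee_fin => _ ek; apply: (le_trans ek).
(* This absorbs the additive constant of [k + 1 <= K + 2] into the multiple of [sqrt N]. *)
have s1 : 1 <= Num.sqrt N%:R :> R by rewrite -[leLHS]sqrtr1 ler_wsqrtr.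
have : K = 8 * Num.sqrt C * Num.sqrt N%:R by rewrite /K sqrtrM// mulrC; ring.
by lra.
Qed.

End GridBoundedLaw.

(** * The lower bound from diagonal boxes *)

Section LowerBound.
Variables (R : realType) (mu : probability (plane R) R).

(** Half-open sides keep points of consecutive boxes strictly ordered in both coordinates. *)
Definition diagonal_box (u w : R) : set (plane R) :=
  `]u, u + w] `*` `]u, u + w].

Lemma measurable_diagonal_box u w : measurable (diagonal_box u w).
Proof. by apply: measurableX; exact: measurable_itv. Qed.

Definition missed_box N (D : set (plane R)) : set (N.-tuple (plane R)) :=
  [set X | forall k, (~` D) (tnth X k)].

Lemma missed_boxE N D : @missed_box N D =
  points_in [the N.-tuple 'I_N of ord_tuple N] (fun=> ~` D).
Proof.
apply/seteqP; split=> X h k /=; first exact: h.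
by have := h k; rewrite tnth_ord_tuple.
Qed.

Lemma measurable_missed_box N D : measurable D -> measurable (@missed_box N D).
Proof.
move=> mD; rewrite missed_boxE.
by apply: measurable_points_in => _; exact: measurableC.
Qed.

(** One point misses [D] with probability at most [1 - r / N <= expR (- (r / N))], and the [N]
    points are independent. *)
Lemma iid_law_missed_box_le N D (r : R) : measurable D -> (0 < N)%N ->
  ((r / N%:R)%:E <= mu D)%E -> (iid_law mu N (@missed_box N D) <= (expR (- r))%:E)%E.
Proof.
move=> mD N0 rD; rewrite missed_boxE.
have N0' : (0 : R) < N%:R by rewrite ltr0n.
have -> : expR (- r) = expR (- (r / N%:R)) ^+ N.
  by rewrite -expRM_natl -mulr_natl; congr expR; field; rewrite gt_eqF.
have muC : (mu (~` D) <= (expR (- (r / N%:R)))%:E)%E.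
  have -> : (mu (~` D) = 1 - mu D)%E by exact: probability_setC.
  have : mu D \is a fin_num by exact: fin_num_measure.
  move: rD.
  case: (mu D) => [x| |]//; rewrite lee_fin => rx _.
  rewrite -EFinB lee_fin (le_trans _ (expR_ge1Dx _))//.
  by rewrite lerD2l lerN2.
apply: iid_law_points_in_le; first by rewrite enum_uniq.
  by move=> _; exact: measurableC.
by move=> _; exact: muC.
Qed.

Section DiagonalBoxes.
Variables (a w : R) (m N : nat) (X : N.-tuple (plane R)).
Hypothesis w0 : 0 < w.

Let D i := diagonal_box (a + i%:R * w) w.

(** The sum counts the boxes that are hit; one point chosen from each, in the order of the boxes,
    forms an increasing chain. *)
Lemma LIS_hit_boxes : ~ with_ties X ->
  \sum_(i < m) (\1_(~` missed_box (D i)) X : R) <= (LIS (Perm X))%:R.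
Proof.
move=> /without_ties_inj[ix iy].
pose I := [seq i : 'I_m <- enum 'I_m | X \in ~` missed_box (D i)].
have -> : \sum_(i < m) (\1_(~` missed_box (D i)) X : R) = (size I)%:R.
  rewrite size_filter -sum1_count natr_sum big_enum_cond/= [RHS]big_mkcond/=.
  by apply: eq_bigr => i _; rewrite indicE; case: ifP.
rewrite ler_nat.
have hitP i : i \in I -> exists k, D i (tnth X k).
  rewrite mem_filter => /andP[+ _]; rewrite inE => h.
  by apply: contra_notP h => /forallNP h k; exact: h.
(* With no box hit the claim is trivial; otherwise a hit box supplies the default index [k0] used in
   [f]. *)
have [->//|[i0 /hitP[k0 _]]] : size I = 0%N \/ exists i0, i0 \in I.
  by case: (I) => [|i0 I']; [left|right; exists i0; rewrite mem_head].
pose f (i : 'I_m) := odflt k0 [pick k | `[< D i (tnth X k) >]].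
have fP i : i \in I -> D i (tnth X (f i)).
  move=> /hitP[k Dk]; rewrite /f; case: pickP => [l /asboolP//|/(_ k)].
  by move/negP; case; apply/asboolP.
apply: has_increasing_subseq_LIS.
apply/(has_increasing_subseq_PermP ix iy); exists [tuple of map f (in_tuple I)].
have Isort : sorted (fun i j : 'I_m => i < j)%N I.
  apply: sorted_filter; first by move=> x y z; exact: ltn_trans.
  by have := iota_ltn_sorted 0 m; rewrite -val_enum_ord sorted_map.
have sep (u v : R) i j : (i < j)%N -> u \in `]a + i%:R * w, a + i%:R * w + w] ->
    v \in `]a + j%:R * w, a + j%:R * w + w] -> u < v.
  move=> ij; rewrite !in_itv/= => /andP[_ u1] /andP[v1 _].
  apply: le_lt_trans u1 (le_lt_trans _ v1).
  by rewrite -addrA lerD2l -[X in _ + X]mul1r -mulrDl ler_pM2r// natr1 ler_nat.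
have allI : all (mem I) I by apply/allP.
rewrite /increasing_points /= !sorted_map; apply/andP; split.
  apply: (sub_in_sorted _ allI) Isort => i j iI jI ij /=.
  exact: sep ij (fP i iI).1 (fP j jI).1.
apply: (sub_in_sorted _ allI) Isort => i j iI jI ij /=.
exact: sep ij (fP i iI).2 (fP j jI).2.
Qed.

End DiagonalBoxes.

(** With [m] the integer part of [sqrt N], each of [m] boxes of side [s / m] has mass at least
    [c s ^ 2 / m ^ 2 >= r / N], hence is hit with probability at least [eta]. Linearity of
    expectation gives [m * eta]. *)
Lemma sqrt_le_expected_LIS (a s c : R) : 0 < s -> 0 < c ->
    (forall N, (iid_law mu N (@with_ties R N) = 0)%E) ->
    (forall u w, a <= u -> 0 <= w -> u + w <= a + s ->
      ((c * w ^+ 2)%:E <= mu (diagonal_box u w))%E) ->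
  exists2 c', 0 < c' &
    forall N, (0 < N)%N -> c' * Num.sqrt N%:R <= expected_LIS mu N.
Proof.
move=> s0 c0 ties muD; pose r := c * s ^+ 2; pose eta := 1 - expR (- r).
have r0 : 0 < r by rewrite mulr_gt0// exprn_gt0.
have eta0 : 0 < eta by rewrite subr_gt0 expR_lt1 oppr_lt0.
exists (eta / 2); first by rewrite divr_gt0.
move=> N N0; pose m := Num.truncn (Num.sqrt N%:R : R).
have N0' : (0 : R) < N%:R by rewrite ltr0n.
have sN1 : 1 <= Num.sqrt N%:R :> R by rewrite -[leLHS]sqrtr1 ler_wsqrtr// ler1n.
have /andP[mN Nm] : m%:R <= (Num.sqrt N%:R : R) < m.+1%:R.
  exact: truncn_itv.
have m0 : (0 < m)%N by rewrite truncn_gt0.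
have m0' : (0 : R) < m%:R by rewrite ltr0n.
pose w := s / m%:R; have w0 : 0 < w by rewrite divr_gt0.
pose D i := diagonal_box (a + i%:R * w) w.
have mD i : measurable (D i) by exact: measurable_diagonal_box.
(* Samples with ties are removed because [LIS_hit_boxes] does not cover them; this costs no
   probability. *)
pose A i := ~` missed_box (D i) `\` @with_ties R N.
have mA i : measurable (A i).
  apply: measurableD; last exact: measurable_with_ties.
  by apply: measurableC; exact: measurable_missed_box.
have PA i : (i < m)%N -> (eta%:E <= iid_law mu N (A i))%E.
  move=> im; have h : (iid_law mu N (~` A i) <= (expR (- r))%:E)%E.
    have -> : ~` A i = missed_box (D i) `|` @with_ties R N.
      by rewrite /A setDE setCI !setCK.
    apply: (le_trans (measureU2 _ _ _)).
    - exact: measurable_missed_box.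
    - exact: measurable_with_ties.
    rewrite [X in (_ + X)%E](_ : _ = 0%E) ?adde0; last exact: ties.
    apply: iid_law_missed_box_le => //.
    have hD : ((c * w ^+ 2)%:E <= mu (D i))%E.
      apply: muD; rewrite ?(ltW w0)//.
        by rewrite lerDl mulr_ge0// (ltW w0).
      rewrite -addrA lerD2l -{2}[w]mul1r -mulrDl natr1 /w mulrCA ger_pMr//.
      by rewrite ler_pdivrMr// mul1r ler_nat.
    apply: le_trans hD; rewrite lee_fin /r -mulrA ler_pM2l// /w expr_div_n.
    rewrite ler_pM2l ?exprn_gt0// lef_pV2 ?posrE ?exprn_gt0//.
    have -> : N%:R = (Num.sqrt N%:R : R) ^+ 2 by rewrite sqr_sqrtr ?ltW.
    by rewrite ler_pXn2r ?nnegrE ?sqrtr_ge0 ?ler0n.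
  move: h; have -> : (iid_law mu N (~` A i) = 1 - iid_law mu N (A i))%E.
    exact: probability_setC.
  have : iid_law mu N (A i) \is a fin_num by exact: fin_num_measure.
  case: (iid_law _ _ _) => [x| |]//= _; rewrite -EFinB !lee_fin /eta; lra.
have bnd : ((m%:R * eta)%:E <= 'E_(iid_law mu N)[fun X => (LIS (Perm X))%:R])%E.
  rewrite unlock.
  apply: (@le_trans _ _ (\int[iid_law mu N]_X (\sum_(i < m) (\1_(A i) X)%:E))%E).
    rewrite ge0_integral_sum//; last first.
      by move=> i; apply/measurable_EFinP; exact: measurable_indic.
    rewrite (_ : (m%:R * eta)%:E = \sum_(i < m) eta%:E)%E; last first.
      by rewrite sumEFin sumr_const card_ord mulr_natl.
    apply: lee_sum => i _; rewrite integral_indic// setIT; exact: PA.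
  apply: le_ge0_integral => X.
    by apply: sume_ge0 => i _; rewrite lee_fin.
  rewrite sumEFin lee_fin.
  have [tX|nX] := pselect (with_ties X).
    rewrite big1// => i _; rewrite indicE memNset// => -[_]; exact.
  rewrite (le_trans _ (LIS_hit_boxes a m w0 nX))// ler_sum// => i _.
  by rewrite !indicE; case: (boolP (X \in A i)) => // /set_mem[/mem_set-> _].
(* A lower bound survives [fine] only once the value [+oo] is excluded. *)
have Efin : ('E_(iid_law mu N)[fun X => (LIS (Perm X))%:R] <= N%:R%:E)%E.
  rewrite unlock; apply: (@le_trans _ _ (\int[iid_law mu N]_X (N%:R)%:E)%E).
    by apply: le_ge0_integral => X; rewrite lee_fin// ler_nat LIS_leq.
  by rewrite integral_cst//= probability_setT mule1.
rewrite /expected_LIS; move: bnd Efin.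
case: ('E_ _ [_])%E => [e| |] //=; rewrite !lee_fin => me _.
(* Rounding [sqrt N] down to [m] costs at most a factor 2, whence the constant [eta / 2]. *)
have m2 : m.+1%:R <= 2 * m%:R :> R by rewrite -natrM ler_nat mul2n -addnn -addn1 leq_add2l.
have : eta * Num.sqrt N%:R <= eta * (2 * m%:R) by rewrite ler_wpM2l ?(ltW eta0)//; lra.
by lra.
Qed.

End LowerBound.

(** * The quantile grid of a power weight *)

Section PowerWeight.
Variables (R : realType) (gam : R).
Hypothesis gam0 : 0 < gam.

(** The primitive of [weight] is [- (1 - x) `^ gam / gam], so that [weight] is
    integrable up to [1] although it may blow up there. *)
Definition weight (x : R) : R := (1 - x) `^ (gam - 1).

Lemma measurable_weight (D : set (measurableTypeR R)) :
  measurable_fun D (weight : measurableTypeR R -> R).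
Proof.
apply: measurable_funTS; apply: (measurableT_comp (measurable_powR _)).
exact: measurable_funB.
Qed.

Lemma is_derive_onem_powR (p x : R) : x < 1 ->
  is_derive x 1 (fun y => (1 - y) `^ p) (- (p * (1 - x) `^ (p - 1))).
Proof.
move=> x1; have x1' : 0 < 1 - x by rewrite subr_gt0.
have h1 : is_derive x (1 : R) (fun y : R => 1 - y) (- 1).
  rewrite -[X in is_derive _ _ _ X]add0r.
  by apply: is_deriveD.
have := @is_derive1_comp _ _ _ x _ _ (@is_derive1_powR _ p _ x1') h1.
by rewrite mulrN1.
Qed.

Lemma integral_weight_itvcc (a b : R) : a <= b -> b < 1 ->
  (\int[lebesgue_measure]_(x in `[a, b]) (weight x)%:E =
   (((1 - a) `^ gam - (1 - b) `^ gam) / gam)%:E)%E.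
Proof.
rewrite le_eqVlt => /predU1P[-> _|ab b1].
  by rewrite set_itv1 integral_set1 subrr mul0r.
pose F x : R := - gam^-1 * (1 - x) `^ gam.
have dF (x : R) : x < 1 -> is_derive x 1 F (weight x).
  move=> x1; have h := is_derive_onem_powR gam x1.
  have -> : weight x = - gam^-1 * - (gam * (1 - x) `^ (gam - 1)).
    by rewrite mulrNN mulrA mulVf ?mul1r// gt_eqF.
  exact: is_deriveZ.
have cF (x : R) : x < 1 -> F y @[y --> x] --> F x.
  move=> /dF[d _]; apply/differentiable_continuous.
  by rewrite -derivable1_diffP.
rewrite (@continuous_FTC2 _ weight F)//.
- by rewrite -EFinB /F; congr EFin; ring.
- apply: derivable_within_continuous => x; rewrite in_itv/= => /andP[_ xb].
  by have [] := is_derive_onem_powR (gam - 1) (le_lt_trans xb b1).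
- split.
  + by move=> x; rewrite in_itv/= => /andP[_ xb]; have [] := dF _ (lt_trans xb b1).
  + by apply: cvg_at_right_filter; apply: cF; exact: lt_trans b1.
  + by apply: cvg_at_left_filter; exact: cF.
- move=> x; rewrite in_itv/= => /andP[_ xb].
  by have [_] := dF _ (lt_trans xb b1); rewrite derive1E.
Qed.

(** The case [b = 1], where the weight may blow up, is reached by monotone convergence along the
    closed intervals [[a, u n]]. *)
Lemma integral_weight_itvco (a b : R) : a <= b -> b <= 1 ->
  (\int[lebesgue_measure]_(x in `[a, b[) (weight x)%:E <=
   (((1 - a) `^ gam - (1 - b) `^ gam) / gam)%:E)%E.
Proof.
rewrite le_eqVlt => /predU1P[-> _|ab b1].
  by rewrite set_itvco0 integral_set0 subrr mul0r.
pose u n : R := b - (b - a) / n.+1%:R.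
have ba : 0 < b - a by rewrite subr_gt0.
have ub n : u n < b by rewrite ltrBlDr ltrDl divr_gt0.
have au n : a <= u n.
  rewrite /u lerBrDr -lerBrDl ler_pdivrMr// ler_peMr ?ler1n// ltW//.
have und m n : (m <= n)%N -> u m <= u n.
  move=> mn; rewrite /u lerD2l lerN2 ler_pM2l// lef_pV2 ?posrE ?ltr0n//.
  by rewrite ler_nat.
have -> : `[a, b[%classic = \bigcup_n `[a, u n]%classic.
  apply/seteqP; split=> [x|x [n _]] /=; rewrite !in_itv/= => /andP[ax xb]; last first.
    by rewrite ax (le_lt_trans xb).
  (* Since [n + 1 > (b - a) / (b - x)], the point [x] lies below [u n]. *)
  pose n := Num.truncn ((b - a) / (b - x)).
  exists n => //=; rewrite in_itv/= ax/= /u lerBrDr -lerBrDl.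
  have bx : 0 < b - x by rewrite subr_gt0.
  rewrite ler_pdivrMr// mulrC -ler_pdivrMr// ltW//; exact: truncnS_gt.
have mw n : measurable_fun `[a, u n] (EFin \o weight).
  by apply/measurable_EFinP; exact: measurable_weight.
have ndu : nondecreasing_seq (fun n => `[a, u n]%classic).
  move=> m n mn; apply/subsetPset => x /=; rewrite !in_itv/= => /andP[-> /=].
  by move/le_trans; apply; exact: und.
have w0 n x : `[a, u n]%classic x -> (0 <= (weight x)%:E)%E.
  by move=> _; rewrite lee_fin powR_ge0.
have cv : (\int[lebesgue_measure]_(x in `[a, u n]) (weight x)%:E)%E @[n --> \oo] -->
    (\int[lebesgue_measure]_(x in \bigcup_n `[a, u n]%classic) (weight x)%:E)%E.
  exact: ge0_nondecreasing_set_cvg_integral.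
rewrite -(cvg_lim _ cv)//; apply: lime_le; first by apply/cvg_ex; eexists; exact: cv.
apply: nearW => n; rewrite integral_weight_itvcc//; last exact: lt_le_trans b1.
rewrite lee_fin ler_pM2r ?invr_gt0// lerD2l lerN2.
apply: ge0_ler_powR; rewrite ?nnegrE ?subr_ge0// ?ltW//.
  exact: lt_le_trans b1.
by rewrite ltrD2l ltrN2.
Qed.

(** The integer part of [M] times the distribution function of the probability density
    [gam * weight] on [[0, 1]]. [Num.max] and the truncation of negative values to 0 keep it
    monotone on the whole line. *)
Definition weight_grid (M : nat) (x : R) : nat :=
  Num.truncn (M%:R * (1 - (Num.max 0 (1 - x)) `^ gam)).

Lemma weight_grid_homo M : {homo weight_grid M : x y / x <= y >-> (x <= y)%N}.
Proof.
move=> x y xy; apply: le_truncn; rewrite ler_wpM2l// lerD2l lerN2.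
apply: ge0_ler_powR; first exact: ltW.
- by rewrite nnegrE le_max lexx.
- by rewrite nnegrE le_max lexx.
- by rewrite ge_max !le_max lexx/= lerD2l lerN2 xy orbT.
Qed.

Lemma weight_grid_le M x : (weight_grid M x <= M)%N.
Proof.
rewrite -[leqRHS](@natrK R); apply: le_truncn.
by rewrite ler_piMr// gerBl powR_ge0.
Qed.

Lemma weight_grid_cell M i : (0 < M)%N -> exists a b : R,
  [/\ a <= b, b <= 1,
      (1 - a) `^ gam - (1 - b) `^ gam <= M%:R^-1 &
      forall x, 0 <= x < 1 -> weight_grid M x = i -> x \in `[a, b[].
Proof.
move=> M0; have M0' : (0 : R) < M%:R by rewrite ltr0n.
have itv x : 0 <= x < 1 -> weight_grid M x = i ->
    [/\ 0 < (1 - x) `^ gam, i%:R / M%:R <= 1 - (1 - x) `^ gam &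
      1 - (1 - x) `^ gam < i.+1%:R / M%:R].
  move=> /andP[x0 x1] xi; have x1' : 0 < 1 - x by rewrite subr_gt0.
  have p0 : 0 < (1 - x) `^ gam by rewrite powR_gt0.
  have p1 : (1 - x) `^ gam <= 1.
    suff : (1 - x) `^ gam <= 1 `^ gam by rewrite powR1.
    by apply: ge0_ler_powR; rewrite ?nnegrE ?(ltW gam0) ?(ltW x1')//; lra.
  move: xi; rewrite /weight_grid max_r ?(ltW x1')// => xi.
  have v0 : 0 <= M%:R * (1 - (1 - x) `^ gam) by rewrite mulr_ge0 ?subr_ge0.
  have := truncn_itv v0; rewrite xi => /andP[h1 h2]; split=> //.
    by rewrite ler_pdivrMr// mulrC.
  by rewrite ltr_pdivlMr// mulrC.
have [iM|Mi] := ltnP i M; last first.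
  (* For [x < 1] the grid number stays below [M], so this level is empty there and a degenerate
     interval serves. *)
  exists 1, 1; split=> //; first by rewrite subrr invr_ge0 ltW.
  move=> x x01 /(itv _ x01)[p0 p1 _].
  have : 1 <= i%:R / M%:R :> R by rewrite ler_pdivlMr// mul1r ler_nat.
  by move: (i%:R / M%:R) p0 p1 => s; lra.
have t0 k : (k <= M)%N -> 0 <= 1 - k%:R / M%:R :> R.
  by move=> kM; rewrite subr_ge0 ler_pdivrMr// mul1r ler_nat.
have ti := t0 i (ltnW iM); have ti1 := t0 _ iM.
have powK t : 0 <= t -> (t `^ gam^-1) `^ gam = t.
  by move=> t00; rewrite -powRrM mulVf ?powRr1// gt_eqF.
have powKV t : 0 <= t -> (t `^ gam) `^ gam^-1 = t.
  by move=> t00; rewrite -powRrM mulfV ?powRr1// gt_eqF.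
(* The quantile of order [k / M], that is, the solution of [1 - (1 - c) ^ gam = k / M]. *)
pose c k : R := 1 - (1 - k%:R / M%:R) `^ gam^-1.
have cE k : (k <= M)%N -> (1 - c k) `^ gam = 1 - k%:R / M%:R.
  by move=> kM; rewrite /c opprB addrC subrK powK// t0.
have iV0 : 0 < gam^-1 by rewrite invr_gt0.
exists (c i), (c i.+1); split.
- rewrite lerD2l lerN2; apply: ge0_ler_powR; rewrite ?nnegrE ?ti ?ti1 ?(ltW iV0)//.
  by rewrite lerD2l lerN2 ler_pM2r ?invr_gt0// ler_nat.
- by rewrite gerBl powR_ge0.
- rewrite (cE _ (ltnW iM)) (cE _ iM).
  have -> : i.+1%:R / M%:R = i%:R / M%:R + M%:R^-1 :> R by rewrite -natr1 mulrDl mul1r.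
  by have -> : forall s t : R, 1 - s - (1 - (s + t)) = t by move=> s t; ring.
- move=> x x01 /(itv _ x01)[p0 p1 p2]; rewrite in_itv/=.
  have x1 : 0 <= 1 - x by case/andP: x01 => _ /ltW; rewrite subr_ge0.
  apply/andP; split.
    rewrite lerBlDr -lerBlDl -(powKV _ x1).
    apply: ge0_ler_powR; rewrite ?nnegrE ?ti ?ti1 ?(ltW iV0) ?powR_ge0//.
    by rewrite lerBrDl -lerBrDr.
  rewrite ltrBrDr -ltrBrDl -(powKV _ x1).
  apply: gt0_ltr_powR; rewrite ?nnegrE ?ti ?ti1 ?powR_ge0//.
  by rewrite ltrBlDl -ltrBlDr.
Qed.

End PowerWeight.

(** * Integrals of product functions over rectangles *)

Section RectangleIntegral.
Context d1 d2 (T1 : measurableType d1) (T2 : measurableType d2) (R : realType).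
Variable m1 : {sigma_finite_measure set T1 -> \bar R}.
Variable m2 : {sigma_finite_measure set T2 -> \bar R}.

(** Tonelli's theorem, once the restriction to the rectangle is moved into the integrand, where it
    factors. *)
Lemma ge0_integral_setX (I : set T1) (J : set T2) (f : T1 -> \bar R)
    (g : T2 -> \bar R) : measurable I -> measurable J ->
    measurable_fun setT f -> measurable_fun setT g ->
    (forall x, 0 <= f x)%E -> (forall y, 0 <= g y)%E ->
  (\int[m1 \x m2]_(z in I `*` J) (f z.1 * g z.2) =
   (\int[m1]_(x in I) f x) * \int[m2]_(y in J) g y)%E.
Proof.
move=> mI mJ mf mg f0 g0.
have fI0 x : (0 <= (f \_ I) x)%E by exact: erestrict_ge0.
have gJ0 y : (0 <= (g \_ J) y)%E by exact: erestrict_ge0.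
have mfI : measurable_fun setT (f \_ I).
  by apply/(measurable_restrictT _ _).1 => //; exact: measurable_funTS.
have mgJ : measurable_fun setT (g \_ J).
  by apply/(measurable_restrictT _ _).1 => //; exact: measurable_funTS.
rewrite integral_mkcond [in RHS]integral_mkcond [X in (_ * X)%E]integral_mkcond.
rewrite (_ : _ \_ _ = fun z => ((f \_ I) z.1 * (g \_ J) z.2)%E); last first.
  apply/funext => -[x y]; rewrite !patchE /= in_setX /=.
  by case: (x \in I); case: (y \in J); rewrite /= ?mule0 ?mul0e.
rewrite fubini_tonelli1//=; last 2 first.
- by apply: emeasurable_funM; exact: measurableT_comp.
- by move=> z; exact: mule_ge0.
rewrite /fubini_F/=.
under eq_integral do rewrite ge0_integralZl//.
by rewrite ge0_integralZr// integral_ge0.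
Qed.

End RectangleIntegral.

(** * From a product bound on the density to a grid bound on its law *)

Section DensityGrid.
Variables (R : realType) (rho : R * R -> R) (rhoP : is_density rho).
Variables (gam K C : R).
Hypotheses (gam0 : 0 < gam) (K0 : 0 <= K) (KC : K / gam ^+ 2 <= C).
Hypothesis rho_le : forall x y : R, 0 <= x < 1 -> 0 <= y < 1 ->
  rho (x, y) <= K * (weight gam x * weight gam y).

(** [rho_le] speaks only of points with both coordinates below 1; within the square this null set
    contains all the others. *)
Let edge : set (plane R) := [set 1] `*` setT `|` setT `*` [set 1].

Let measurable_edge : measurable edge.
Proof. by apply: measurableU; apply: measurableX. Qed.

Let edge0 : (@lebesgue2 R) edge = 0%E.
Proof.
have e1 : (@lebesgue2 R ([set 1%R] `*` setT) = 0)%E.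
  transitivity (lebesgue_measure [set (1%R : R)] * lebesgue_measure [set: R])%E.
    exact: product_measure1E.
  by rewrite lebesgue_measure_set1 mul0e.
have e2 : (@lebesgue2 R (setT `*` [set 1%R]) = 0)%E.
  transitivity (lebesgue_measure [set: R] * lebesgue_measure [set (1%R : R)])%E.
    exact: product_measure1E.
  by rewrite lebesgue_measure_set1 mule0.
apply/eqP; rewrite eq_le measure_ge0 andbT.
rewrite (le_trans (measureU2 _ _ _))//; [by apply: measurableX..|].
suff : (@lebesgue2 R ([set 1%R] `*` setT) + @lebesgue2 R (setT `*` [set 1%R]) <= 0)%E by [].
by rewrite e1 e2 adde0.
Qed.

(** Each side of a cell carries weight at most [1 / (M gam)], so by Tonelli the mass of the cell is
    at most [K / (M gam) ^ 2 <= C / M ^ 2]. *)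
Lemma density_law_grid_bounded :
  grid_bounded (density_law rhoP) C (weight_grid gam).
Proof.
move=> M M0; split.
- exact: weight_grid_homo.
- exact: weight_grid_le.
move=> i j; have M0' : (0 : R) < M%:R by rewrite ltr0n.
have [a [b [ab b1 abM abP]]] := weight_grid_cell gam0 i M0.
have [c [d [cd d1 cdM cdP]]] := weight_grid_cell gam0 j M0.
set D := (_ `*` _ : set (plane R)).
have mQ k : measurable (weight_grid gam M @^-1` [set k] : set (measurableTypeR R)).
  apply: is_interval_measurable => x y /= xk yk z /andP[xz zy].
  apply/eqP; rewrite eqn_leq -{1}yk -xk !weight_grid_homo//.
have mS : measurable (@unit_square R : set (plane R)).
  by apply: measurableX; exact: measurable_itv.
have mD : measurable (D `&` @unit_square R).
  by apply: measurableI => //; exact: measurableX.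
have [mrho rho0 _] := rhoP.
have mrhoD : measurable_fun (D `&` @unit_square R : set (plane R)) (EFin \o rho).
  by apply/measurable_EFinP; apply: measurable_funS mrho => // z [].
have muE : (density_law rhoP D =
    \int[@lebesgue2 R]_(z in (D `&` @unit_square R) `\` edge) (rho z)%:E)%E.
  apply: ge0_negligible_integral => //.
  by move=> z [_ /rho0]; rewrite lee_fin.
suff : (\int[@lebesgue2 R]_(z in (D `&` @unit_square R) `\` edge) (rho z)%:E
    <= (C / M%:R ^+ 2)%:E)%E by rewrite -muE.
pose I : set (measurableTypeR R) := `[a, b[%classic.
pose J : set (measurableTypeR R) := `[c, d[%classic.
pose h (z : plane R) : \bar R := ((K * weight gam z.1)%:E * (weight gam z.2)%:E)%E.
have mh : measurable_fun setT h.
  apply: emeasurable_funM; apply: measurableT_comp => //.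
    apply: measurable_funM => //.
    by apply: measurableT_comp => //; exact: measurable_weight.
  by apply: measurableT_comp => //; exact: measurable_weight.
have h0 z : (0 <= h z)%E.
  by rewrite mule_ge0// lee_fin ?mulr_ge0// powR_ge0.
have sub : (D `&` @unit_square R) `\` edge `<=` I `*` J /\
  {in ((D `&` @unit_square R) `\` edge), forall z, ((rho z)%:E <= h z)%E}.
  have key z : ((D `&` @unit_square R) `\` edge) z ->
      [/\ 0 <= z.1 < 1, 0 <= z.2 < 1, weight_grid gam M z.1 = i &
          weight_grid gam M z.2 = j].
    case: z => x y [[[/= Dx Dy]] [/=]]; rewrite !in_itv/= => /andP[x0 x1] /andP[y0 y1].
    move=> ne; split=> //.
      rewrite x0 lt_neqAle x1 andbT; apply/eqP => xE.
      by apply: ne; left; split.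
    rewrite y0 lt_neqAle y1 andbT; apply/eqP => yE.
    by apply: ne; right; split.
  split=> [z /key[z1 z2 zi zj]|z /set_mem/key[z1 z2 _ _]].
    by split; [exact: abP|exact: cdP].
  rewrite /h -EFinM lee_fin -mulrA; case: z z1 z2 => x y; exact: rho_le.
have [subIJ rhoh] := sub.
apply: (@le_trans _ _ (\int[@lebesgue2 R]_(z in I `*` J) h z)%E).
  apply: (@le_trans _ _
      (\int[@lebesgue2 R]_(z in (D `&` @unit_square R) `\` edge) h z)%E).
    apply: ge0_le_integral => //.
    - exact: measurableD.
    - by move=> z [[_ /rho0]]; rewrite lee_fin.
    - by apply: measurable_funS mrhoD => //; exact: subDsetl.
    - exact: measurable_funTS.
    - by move=> z zD; apply: rhoh; rewrite inE.
  apply: ge0_subset_integral => //.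
  - exact: measurableD.
  - by apply: measurableX; exact: measurable_itv.
  - exact: measurable_funTS.
rewrite /h /lebesgue2 (@ge0_integral_setX _ _ _ _ _ _ _ I J
  (fun x => (K * weight gam x)%:E) (fun y => (weight gam y)%:E))//.
- under eq_integral do rewrite EFinM.
  have wI (s t : R) : s <= t -> t <= 1 ->
      (1 - s) `^ gam - (1 - t) `^ gam <= M%:R^-1 ->
      (\int[lebesgue_measure]_(x in `[s, t[) (weight gam x)%:E <= ((M%:R * gam)^-1)%:E)%E.
    move=> ab' b1' abM'; rewrite (le_trans (integral_weight_itvco gam0 ab' b1'))//.
    by rewrite lee_fin invfM ler_pM2r ?invr_gt0.
  rewrite ge0_integralZl//; last 2 first.
  + by apply/measurable_EFinP; exact: measurable_weight.
  + by move=> x _; rewrite lee_fin powR_ge0.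
  apply: (@le_trans _ _ (K%:E * ((M%:R * gam)^-1)%:E * ((M%:R * gam)^-1)%:E)%E).
    apply: lee_pmul; [| |apply: lee_wpmul2l => //; exact: wI|exact: wI].
      by rewrite mule_ge0// integral_ge0// => x _; rewrite lee_fin powR_ge0.
    by rewrite integral_ge0// => x _; rewrite lee_fin powR_ge0.
  rewrite -!EFinM lee_fin.
  have -> : K / (M%:R * gam) / (M%:R * gam) = (K / gam ^+ 2) / M%:R ^+ 2.
    by field; rewrite !gt_eqF.
  by rewrite ler_pM2r// invr_gt0 exprn_gt0.
- exact: measurable_itv.
- exact: measurable_itv.
- exact: measurable_itv.
- apply/measurable_EFinP; apply: measurable_funM => //.
  exact: measurable_weight.
- by apply/measurable_EFinP; exact: measurable_weight.
- by move=> x; rewrite lee_fin mulr_ge0// powR_ge0.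
- by move=> x; rewrite lee_fin powR_ge0.
Qed.

End DensityGrid.

(** * Bounds on the density near the corner *)

Section DensityBox.
Variables (R : realType) (rho : R * R -> R) (rhoP : is_density rho).

Lemma density_law_diagonal_box_ge (u w c : R) : 0 <= c -> 0 <= w ->
    (forall z, diagonal_box u w z -> unit_square z /\ c <= rho z) ->
  ((c * w ^+ 2)%:E <= density_law rhoP (diagonal_box u w))%E.
Proof.
move=> c0 w0 cP; set D := diagonal_box u w.
have mD : measurable D by exact: measurable_diagonal_box.
have [mrho rho0 _] := rhoP.
have DS : D `&` @unit_square R = D.
  by apply/seteqP; split=> [z []//|z Dz]; split=> //; case: (cP z Dz).
have lD : (@lebesgue2 R D = (w ^+ 2)%:E)%E.
  pose J := `]u, u + w]%classic.
  transitivity (lebesgue_measure J * lebesgue_measure J)%E.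
    by apply: product_measure1E; exact: measurable_itv.
  rewrite /J lebesgue_measure_itv/= lte_fin ltrDl; case: ltP => [_|w0'].
    by rewrite -EFinD -EFinM addrAC subrr add0r expr2.
  have -> : w = 0 by apply/eqP; rewrite eq_le w0'.
  by rewrite mule0 expr2 mulr0.
suff : (\int[@lebesgue2 R]_(z in D) (cst c%:E z) <=
        \int[@lebesgue2 R]_(z in D) (rho z)%:E)%E.
  have -> : (\int[@lebesgue2 R]_(z in D) (rho z)%:E = density_law rhoP D)%E.
    by rewrite /density_law DS.
  apply: le_trans; rewrite integral_cst//.
  suff -> : ((c * w ^+ 2)%:E = c%:E * @lebesgue2 R D)%E by [].
  by rewrite lD EFinM.
apply: ge0_le_integral => //.
- by apply/measurable_EFinP; apply: measurable_funS mrho => // [|z /cP[]//];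
    apply: measurableX; exact: measurable_itv.
- by move=> z /cP[_]; rewrite lee_fin.
Qed.

End DensityBox.

Section CornerBounds.
Variables (R : realType) (alpha : R) (rho : R * R -> R).
Hypothesis alpha_gt : -2 < alpha.
Hypothesis rho_cont : {within @unit_square R `\ @corner R, continuous rho}.
Hypothesis rho_corner :
  Theta_corner rho (fun z => (`|z.1 - 1| + `|z.2 - 1|) `^ alpha).

(** Removing the interior of [W] leaves a compact part of the square that avoids the corner, and
    [rho] is continuous there. *)
Lemma bounded_off_corner (W : set (R * R)) : nbhs (@corner R) W ->
  exists2 B, 0 <= B & forall z, unit_square z -> ~ W z -> rho z <= B.
Proof.
move=> /nbhs_interior cW; pose S := @unit_square R `&` ~` interior W.
have cS : compact S.
  apply: compact_closedI; last exact/open_closedC/open_interior.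
  by apply: compact_setX; exact: segment_compact.
have SS : S `<=` @unit_square R `\ @corner R.
  move=> z [Sz nz]; split=> // zc; apply: nz; rewrite zc; exact: nbhs_singleton.
have /compact_bounded[B [_ hB]] := continuous_compact (continuous_subspaceW SS rho_cont) cS.
exists (`|B| + 1); first by rewrite addr_ge0.
move=> z Sz nWz; apply: le_trans (ler_norm _) _.
apply: hB; first by rewrite (le_lt_trans (ler_norm _))// ltrDl.
by exists z => //; split=> // /interior_subset.
Qed.

Lemma powR_ge1 (a p : R) : 0 < a <= 1 -> p <= 0 -> 1 <= a `^ p.
Proof. by move=> a01 p0; have := ger_powR a01 p0; rewrite powRr0. Qed.

Lemma le0_ler_powR (p x y : R) : p <= 0 -> 0 < x -> x <= y -> y `^ p <= x `^ p.
Proof.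
move=> p0 x0 xy; have y0 := lt_le_trans x0 xy.
have [q q0 ->] : exists2 q, 0 <= q & p = - q by exists (- p); rewrite ?oppr_ge0 ?opprK.
rewrite !powRN lef_pV2 ?posrE ?powR_gt0//.
by apply: ge0_ler_powR; rewrite ?nnegrE ?(ltW x0) ?(ltW y0).
Qed.

(** Near the corner the [Theta] bound applies and elsewhere [rho] is bounded; since both weights are
    at least 1 on [[0, 1)], a constant bound is also a multiple of their product. *)
Lemma rho_le_weight : exists gam K : R, [/\ 0 < gam, 0 <= K &
  forall x y : R, 0 <= x < 1 -> 0 <= y < 1 ->
    rho (x, y) <= K * (weight gam x * weight gam y)].
Proof.
have [c1 [c2 [/andP[c10 c12] near_rho]]] := rho_corner.
have [B B0 hB] := bounded_off_corner near_rho.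
have c20 : 0 < c2 := lt_le_trans c10 c12.
pose beta := Num.min alpha 0 / 2.
have beta0 : beta <= 0 by rewrite /beta pmulr_lle0// ge_min lexx orbT.
have beta1 : -1 < beta by rewrite /beta ltr_pdivlMr// mulN1r lt_min alpha_gt oppr_lt0 ltr0n.
(* In [K], the term [2 ^ alpha] serves [alpha >= 0], where [d <= 2]; the term 1 serves [alpha < 0];
   [B] serves points away from the corner. *)
exists (1 + beta), (c2 * (2 `^ alpha + 1) + B); split; first lra.
  by rewrite addr_ge0// mulr_ge0 ?(ltW c20)// addr_ge0// powR_ge0.
move=> x y /andP[x0 x1] /andP[y0 y1]; rewrite /weight addrAC subrr add0r.
have a01 : 0 < 1 - x <= 1 by apply/andP; split; lra.
have b01 : 0 < 1 - y <= 1 by apply/andP; split; lra.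
have wx := powR_ge1 a01 beta0; have wy := powR_ge1 b01 beta0.
set p := _ `^ beta * _.
have p1 : 1 <= p by have := ler_pM ler01 ler01 wx wy; rewrite mulr1.
have Sxy : unit_square (x, y) by split; rewrite /= in_itv/=; apply/andP; split; lra.
pose W := [set z | unit_square z -> z <> @corner R ->
   c1 * (`|z.1 - 1| + `|z.2 - 1|) `^ alpha <= rho z <=
   c2 * (`|z.1 - 1| + `|z.2 - 1|) `^ alpha].
have [Wz|nWz] := pselect (W (x, y)); last first.
  rewrite (le_trans (hB _ Sxy nWz))// -[leLHS]mulr1 ler_pM// lerDr.
  by rewrite mulr_ge0 ?(ltW c20)// addr_ge0// powR_ge0.
have /andP[_] : c1 * (`|x - 1| + `|y - 1|) `^ alpha <= rho (x, y) <=
   c2 * (`|x - 1| + `|y - 1|) `^ alpha.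
  by apply: Wz => // -[xE _]; move: x1; rewrite xE ltxx.
move/le_trans; apply; rewrite distrC [X in _ + X]distrC !gtr0_norm ?subr_gt0//.
case/andP: a01 => a0 a1; case/andP: b01 => b0 b1.
have two0 := powR_ge0 (2 : R) alpha.
rewrite mulrDl; apply: ler_wpDr; first by rewrite mulr_ge0// (le_trans ler01).
rewrite -mulrA ler_pM2l//.
have [alpha0|alpha0] := leP 0 alpha.
  apply: (@le_trans _ _ (2 `^ alpha)).
    by apply: ge0_ler_powR; rewrite ?nnegrE//; lra.
  rewrite -[leLHS]mulr1 ler_pM//; lra.
rewrite -[leLHS]mul1r ler_pM ?powR_ge0//; first by rewrite lerDr.
have betaE : beta = alpha / 2 by rewrite /beta min_l// ltW.
rewrite /p -powRM ?(ltW a0) ?(ltW b0)//.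
have -> : alpha = 2%:R * beta by rewrite betaE; field.
rewrite powRrM powR_mulrn; last by rewrite addr_ge0 ?(ltW a0) ?(ltW b0).
(* [(1 - x) (1 - y) <= d ^ 2], and [t `^ beta] is nonincreasing in [t]. *)
apply: le0_ler_powR => //; first exact: mulr_gt0.
by nra.
Qed.

(** Both coordinates lie at distance between [t / 2] and [t] from 1, so [d] lies between [t] and
    [2 t] and [d ^ alpha] is at least its smaller endpoint value, whatever the sign of [alpha]. *)
Lemma rho_ge_box : exists a s c : R, [/\ 0 < s, 0 < c &
  forall u w z, a <= u -> 0 <= w -> u + w <= a + s -> diagonal_box u w z ->
    unit_square z /\ c <= rho z].
Proof.
have [c1 [c2 [/andP[c10 c12] /nbhs_ballP[e /= e0 near_rho]]]] := rho_corner.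
(* [t < e] keeps the square in the ball where the [Theta] bound holds, and [t <= 1 / 2] keeps it in
   the unit square. *)
pose t := Num.min e 1 / 2.
have m0 : 0 < Num.min e 1 by rewrite lt_min e0 ltr01.
have t0 : 0 < t by rewrite divr_gt0.
have te : t < e.
  by rewrite /t ltr_pdivrMr// (@le_lt_trans _ _ e) ?ge_min ?lexx//; lra.
have t1 : t <= 1 / 2 by rewrite /t ler_pM2r ?invr_gt0// ge_min lexx orbT.
pose m := Num.min (t `^ alpha) ((2 * t) `^ alpha).
have mp : 0 < m by rewrite lt_min !powR_gt0// mulr_gt0.
exists (1 - t), (t / 2), (c1 * m); split; [lra|exact: mulr_gt0|].
move=> u w [x y] au w0 uw [/=]; rewrite !in_itv/= => /andP[x0 x1] /andP[y0 y1].
have Sxy : unit_square (x, y) by split; rewrite /= in_itv/=; apply/andP; split; lra.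
split=> //.
have /andP[+ _] : c1 * (`|x - 1| + `|y - 1|) `^ alpha <= rho (x, y) <=
   c2 * (`|x - 1| + `|y - 1|) `^ alpha.
  apply: (near_rho (x, y)) => //.
    by split; rewrite /ball/= ger0_norm; lra.
  by move=> [xE _]; lra.
apply: le_trans; rewrite ler_pM2l// distrC [X in _ + X]distrC !gtr0_norm ?subr_gt0; [|lra..].
rewrite ge_min; have [alpha0|alpha0] := leP 0 alpha; apply/orP; [left|right].
  by apply: ge0_ler_powR; rewrite ?nnegrE//; lra.
by apply: le0_ler_powR; rewrite ?(ltW alpha0)//; lra.
Qed.

End CornerBounds.

Theorem theorem2p1 (R : realType) (alpha : R) (rho : R * R -> R)
    (rhoP : is_density rho) :
  -2 < alpha ->
  {within @unit_square R `\ @corner R, continuous rho} ->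
  Theta_corner rho (fun z => (`|z.1 - 1| + `|z.2 - 1|) `^ alpha) ->
  tildeTheta (expected_LIS (density_law rhoP)) (fun N => Num.sqrt N%:R).
Proof.
move=> alpha2 rhoC rhoT.
have [gam [K [gam0 K0 rhoK]]] := rho_le_weight alpha2 rhoC rhoT.
pose C := Num.max 1 (K / gam ^+ 2).
have C1 : 1 <= C by rewrite le_max lexx.
have KC : K / gam ^+ 2 <= C by rewrite le_max lexx orbT.
have grid := density_law_grid_bounded rhoP gam0 K0 KC rhoK.
split.
  (* The exponent 0 means that no logarithmic factor is lost; the same holds for the lower bound. *)
  exists (8 * Num.sqrt C + 2), 0, 1%N; split.
    by rewrite ltr_wpDl// mulr_ge0.
  by move=> N N1; rewrite powRr0 mulr1; exact: expected_LIS_le_sqrt grid C1 _ N1.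
have [a [s [c [s0 c0 box]]]] := rho_ge_box rhoT.
(* The grid also serves the lower bound, through the absence of ties. *)
have [c' c'0 lower] := sqrt_le_expected_LIS s0 c0 (iid_law_with_ties grid)
  (fun u w au w0 uw => density_law_diagonal_box_ge rhoP (ltW c0) w0
     (fun z => box u w z au w0 uw)).
exists c'^-1, 0, 1%N; split; first by rewrite invr_gt0.
by move=> N N1; rewrite powRr0 mulr1 ler_pdivlMl//; exact: lower.
Qed.
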